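(* Let $m,n\ge 0$ be fixed integers with $(m,n)\neq(0,1)$ and $(m,n)\neq(0,0)$. For $k\ge 1$, let $G_k$ be a random $(m,n)$-colored mixed graph on the vertex set $\{1,\dots,k\}$ in which, independently for each pair of vertices, the adjacency type between them is chosen uniformly at random among the $2m+n+1$ possibilities (an arc of one of the $m$ colors in one of the two directions, an edge of one of the $n$ colors, or non-adjacency). Then the probability that $G_k$ is an $(m,n)$-clique tends to $1$ as $k\to\infty$.
   Context: An $(m,n)$-colored mixed graph has arcs colored with $m$ colors and edges colored with $n$ colors, with simple underlying undirected graph. A homomorphism $f:G\to H$ maps vertices to vertices so that every arc (resp. edge) $uv$ of color $c$ is sent to an arc (resp. edge) $f(u)f(v)$ of color $c$ (arcs keep direction). $\chi_{(m,n)}(G)$ is the minimum order of an $H$ with $G\to H$, and $G$ is an $(m,n)$-clique if $\chi_{(m,n)}(G)$ equals the number of vertices of $G$. *)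

(* Defs.v *)
From HB Require Import structures.
From mathcomp Require Import all_boot all_order all_algebra.
From mathcomp Require Import all_classical all_reals all_analysis.

Set Implicit Arguments.
Unset Strict Implicit.
Unset Printing Implicit Defensive.

Import Order.TTheory GRing.Theory Num.Theory.
Local Open Scope ring_scope.

(* Adjacency type of an ordered pair (u, v):
     None                   u and v are not adjacent,
     Some (inl (c, true))   there is an arc of colour c from u to v,
     Some (inl (c, false))  there is an arc of colour c from v to u,
     Some (inr c)           there is an edge of colour c between u and v. *)
Definition adjacency (m n : nat) : finType :=
  option (('I_m * bool) + 'I_n)%type.

Definition rev_adj (m n : nat) (a : adjacency m n) : adjacency m n :=
  match a with
  | None => None
  | Some (inl (c, b)) => Some (inl (c, ~~ b))
  | Some (inr c) => Some (inr c)
  end.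

Lemma card_adjacency (m n : nat) : #|adjacency m n| = (2 * m + n + 1)%N.
Proof.
by rewrite card_option card_sum card_prod card_bool !card_ord mulnC addn1.
Qed.

Lemma rev_adjK (m n : nat) : involutive (@rev_adj m n).
Proof. by case=> [[[c b]|c]|] //=; rewrite negbK. Qed.

(* The underlying undirected graph is simple: there are no loops, and each pair
   of vertices carries at most one arc or edge since adj is single-valued. *)
Record mixed_graph (m n : nat) (V : finType) := MixedGraph {
  adj : V -> V -> adjacency m n;
  adj_loopless : forall u, adj u u = None;
  adj_rev : forall u v, adj v u = rev_adj (adj u v) }.

Definition arc (m n : nat) (V : finType) (G : mixed_graph m n V)
  (c : 'I_m) (u v : V) : Prop := adj G u v = Some (inl (c, true)).

Definition edge (m n : nat) (V : finType) (G : mixed_graph m n V)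
  (c : 'I_n) (u v : V) : Prop := adj G u v = Some (inr c).

Definition is_hom (m n : nat) (V W : finType)
    (G : mixed_graph m n V) (H : mixed_graph m n W) (f : V -> W) : Prop :=
  (forall (c : 'I_m) (u v : V), arc G c u v -> arc H c (f u) (f v)) /\
  (forall (c : 'I_n) (u v : V), edge G c u v -> edge H c (f u) (f v)).

Definition maps_to_order (m n : nat) (V : finType) (G : mixed_graph m n V)
    (h : nat) : Prop :=
  exists (W : finType) (H : mixed_graph m n W),
    #|W| = h /\ exists f : V -> W, is_hom G H f.

Lemma maps_to_order_ex (m n : nat) (V : finType) (G : mixed_graph m n V) :
  exists h, `[< maps_to_order G h >].
Proof.
by exists #|V|; apply/asboolP; exists V, G; split=> //; exists id; split.
Qed.

Definition chi (m n : nat) (V : finType) (G : mixed_graph m n V) : nat :=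
  ex_minn (maps_to_order_ex G).

Definition clique (m n : nat) (V : finType) (G : mixed_graph m n V) : bool :=
  chi G == #|V|.

(* Unordered pairs of distinct vertices, listed in increasing order. *)
Definition vpair (k : nat) : finType := {p : 'I_k * 'I_k | (p.1 < p.2)%N}.

Definition outcome (m n k : nat) : finType :=
  {ffun vpair k -> adjacency m n}.

Section GraphOf.
Variables (m n k : nat) (w : outcome m n k).

Definition adj_of (u v : 'I_k) : adjacency m n :=
  if (insub (u, v) : option (vpair k)) is Some p then w p
  else if (insub (v, u) : option (vpair k)) is Some p then rev_adj (w p)
  else None.

Lemma adj_of_loopless u : adj_of u u = None.
Proof. by rewrite /adj_of insubF //= ltnn. Qed.

Lemma adj_of_rev u v : adj_of v u = rev_adj (adj_of u v).
Proof.
rewrite /adj_of; case: (ltngtP u v) => [uv|vu|/val_inj ->].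
- rewrite [insub (v, u)]insubF /=; last by rewrite ltnNge ltnW.
  by case: insubP.
- rewrite [insub (u, v)]insubF /=; last by rewrite ltnNge ltnW.
  by case: insubP => //= p _ _; rewrite rev_adjK.
- by rewrite insubF //= ltnn.
Qed.

Definition graph_of : mixed_graph m n 'I_k :=
  MixedGraph adj_of_loopless adj_of_rev.

End GraphOf.

(* Product of the uniform laws on the 2m+n+1 adjacency types: the adjacency
   types of the pairs are independent and uniform. *)
Definition prob (R : realType) (m n k : nat) (E : pred (outcome m n k)) : R :=
  \sum_(w : outcome m n k | E w)
    \prod_(p : vpair k) (2 * m + n + 1)%N%:R^-1.

Lemma prob_predT (R : realType) (m n k : nat) :
  prob R (@predT (outcome m n k)) = 1.
Proof.
rewrite /prob -(bigA_distr_bigA (fun _ _ => (2 * m + n + 1)%N%:R^-1)) big1//.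
move=> p _; rewrite sumr_const card_adjacency -[LHS]mulr_natr mulVf//.
Qed.

(* Main.v *)
(* If every two distinct vertices u, v have a common neighbour x whose adjacency
   types to u and v differ, then no homomorphism can identify two vertices, and
   the graph is a clique.  Fix two distinct types a, b other than non-adjacency,
   and put N = 2m + n + 1.  The pairs (type of ux, type of vx), for the k - 2
   vertices x outside {u, v}, are independent, and each equals (a, b) with
   probability 1 / N^2, so u, v fail to be separated with probability at most
   (1 - 1 / N^2)^(k - 2).  The union bound over (u, v) then tends to 0. *)

Require Import Defs.
From mathcomp Require Import all_boot all_order all_algebra.
From mathcomp Require Import all_classical all_reals all_analysis.
From mathcomp Require Import ring lra.

Import Order.TTheory GRing.Theory Num.Theory.
Import numFieldNormedType.Exports.
Local Open Scope classical_set_scope.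
Local Open Scope ring_scope.

Set Implicit Arguments.
Unset Strict Implicit.
Unset Printing Implicit Defensive.

Definition separated (m n : nat) (V : finType) (G : mixed_graph m n V)
    (u v : V) : bool :=
  [exists x, [&& adj G u x != None, adj G v x != None & adj G u x != adj G v x]].

Lemma hom_adj (m n : nat) (V W : finType) (G : mixed_graph m n V)
    (H : mixed_graph m n W) (f : V -> W) (u v : V) :
  is_hom G H f -> adj G u v != None -> adj H (f u) (f v) = adj G u v.
Proof.
move=> [farc fedge]; case E: (adj G u v) => [[[c [|]]|c]|//] _.
- exact: farc.
(* [is_hom] only speaks of outgoing arcs, so an incoming one is read from [v] and its image
   reversed. *)
- have: Defs.arc G c v u by rewrite /Defs.arc adj_rev E.
  move/farc; rewrite /Defs.arc adj_rev => /(congr1 (@rev_adj m n)).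
  by rewrite rev_adjK.
- exact: fedge.
Qed.

(** The types of [x] towards [u] and [v] survive in the image, so [f u = f v] would equate them;
    hence every homomorphism is injective and its target has at least [#|V|] vertices. *)
Lemma separated_clique (m n : nat) (V : finType) (G : mixed_graph m n V) :
  (forall u v, u != v -> separated G u v) -> clique G.
Proof.
move=> sepG; rewrite /clique /chi; case: ex_minnP => h /asboolP[W [H [<- [f fH]]]].
move=> minh; apply/eqP/anti_leq/andP; split.
  apply: minh; apply/asboolP; exists V, G; split=> //.
  by exists id; split.
apply: (@leq_card _ _ f) => u v fuv; apply/eqP; apply: contraT => /sepG.
case/existsP => x /and3P[ux vx]; apply: contraNeq => _.
by rewrite -(hom_adj fH ux) -(hom_adj fH vx) fuv.
Qed.

(* Induction on s: overwriting the two coordinates attached to x maps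
   (functions hitting the target at x and avoiding it on s) x A^2 onto all the
   functions avoiding it on s, so at least a share 1 / #|A|^2 of these hit x. *)
Lemma card_avoid_pairs (T D A : finType) (f : D * bool -> T)
    (t : D * bool -> A) (s : seq D) :
  injective f -> uniq s ->
  (#|[pred w : {ffun T -> A} |
       all (fun x => ~~ [forall b, w (f (x, b)) == t (x, b)]) s]|
     * (#|A| ^ 2) ^ size s <= #|A| ^ #|T| * (#|A| ^ 2).-1 ^ size s)%N.
Proof.
move=> injf; elim: s => [_|x s IHs /= /andP[xs us]].
  by rewrite !expn0 !muln1 -card_ffun subset_leq_card //; apply/fintype.subsetP.
set hit := fun (w : {ffun T -> A}) x => [forall b, w (f (x, b)) == t (x, b)].
set P := [pred w : {ffun T -> A} | all (fun x => ~~ hit w x) s].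
have {IHs} := IHs us; rewrite -/P => IHs.
set Q := [pred w | ~~ hit w x && P w].
set Q' := [pred w | hit w x && P w].
have cardP : (#|P| = #|Q'| + #|Q|)%N.
  rewrite -(cardID (fun w => hit w x) P); congr addn; apply: eq_card => w.
  exact: andbC.
pose upd (wc : {ffun T -> A} * {ffun bool -> A}) : {ffun T -> A} :=
  [ffun p => if p == f (x, true) then wc.2 true
             else if p == f (x, false) then wc.2 false else wc.1 p].
have updx w c b : upd (w, c) (f (x, b)) = c b.
  by rewrite ffunE; case: b; rewrite !(inj_eq injf) !xpair_eqE eqxx.
have updy w c y b : y != x -> upd (w, c) (f (y, b)) = w (f (y, b)).
  by move=> yx; rewrite ffunE !(inj_eq injf) !xpair_eqE (negPf yx).
have Pupd w c : P (upd (w, c)) = P w.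
  rewrite /P /=; apply: eq_in_all => y ys; congr (~~ _); apply: eq_forallb => b.
  by rewrite updy //; apply: contraNneq xs => <-.
have le_PQ' : (#|P| <= #|Q'| * #|A| ^ 2)%N.
  have -> : (#|Q'| * #|A| ^ 2 = #|[predX Q' & predT : pred {ffun bool -> A}]|)%N.
    by rewrite cardX card_ffun card_bool.
  apply: leq_trans (leq_image_card upd _); apply: subset_leq_card.
  apply/fintype.subsetP => w Pw. apply/fintype.imageP.
  (* Plant the target at [x] and save the overwritten values of [w] as second component, so that
     [upd] restores them. *)
  exists (upd (w, [ffun b => t (x, b)]), [ffun b => w (f (x, b))]).
    apply/andP; split=> //; apply/andP; split; last exact: etrans (Pupd _ _) Pw.
    by apply/forallP => b; rewrite updx ffunE.
  apply/ffunP => p; rewrite ffunE /= !ffunE.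
  by case: eqP => [->|_] //; case: eqP => [->|].
rewrite -/Q; move: (#|A| ^ 2)%N le_PQ' IHs => N le_PQ' IHs.
(* By [cardP], [#|Q| * N] is [#|P| * N] minus [#|Q'| * N], and the latter is at least [#|P|]. *)
have le_Q : (#|Q| * N <= #|P| * N.-1)%N.
  case: N le_PQ' {IHs} => [|N] le_PQ'; first by rewrite muln0.
  rewrite -(leq_add2l #|P|) -[X in (_ <= X)%N]mulnS.
  by rewrite [in X in (_ <= X)%N]cardP mulnDl leq_add2r.
rewrite !expnS !mulnA; apply: leq_trans (leq_mul le_Q (leqnn _)) _.
by rewrite mulnAC [X in (_ <= X)%N]mulnAC leq_mul2r IHs orbT.
Qed.

Lemma probE (R : realType) (m n k : nat) (E : pred (outcome m n k)) :
  prob R E = #|E|%:R / (#|adjacency m n| ^ #|vpair k|)%:R.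
Proof.
rewrite /prob sumr_const prodr_const card_adjacency natrX exprVn.
by rewrite mulr_natl.
Qed.

Section Coordinates.
Context (m n k : nat).
Implicit Types (u v x : 'I_k) (w : outcome m n k).

Definition sort_pair u x := if (u < x)%N then (u, x) else (x, u).

Lemma sort_pair_lt u x : u != x -> ((sort_pair u x).1 < (sort_pair u x).2)%N.
Proof. by rewrite /sort_pair; case: (ltngtP u x) => // /val_inj ->; rewrite eqxx. Qed.

Definition coord u x (ux : u != x) : vpair k :=
  exist _ (sort_pair u x) (sort_pair_lt ux).

(** An outcome stores each type along the increasing pair only; this is the stored value that means
    type [a] from [u] to [x]. *)
Definition orient (a : adjacency m n) u x := if (u < x)%N then a else rev_adj a.

Lemma adj_of_coord w u x (ux : u != x) a :
  (w (coord ux) == orient a u x) = (adj_of w u x == a).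
Proof.
rewrite /adj_of /orient.
have Ec := valK (coord ux); rewrite /= /sort_pair in Ec.
case: (ltngtP u x) Ec => [lt_ux|lt_xu|/val_inj eq_ux].
- by move=> ->.
- rewrite [insub (u, x)]insubF /= ?ltnNge ?(ltnW lt_xu) // => ->.
  by rewrite -(inj_eq (inv_inj (@rev_adjK m n))) rev_adjK.
- by case/eqP: ux.
Qed.

Lemma coord_eq u x v y (ux : u != x) (vy : v != y) :
  coord ux = coord vy -> (u = v /\ x = y) \/ (u = y /\ x = v).
Proof.
move/(congr1 val); rewrite /= /sort_pair.
by do 2 case: ifP => _; case=> -> ->; auto.
Qed.

End Coordinates.

Lemma prob_not_separated (R : realType) (m n k : nat) (u v : 'I_k)
    (a b : adjacency m n) :
  u != v -> a != None -> b != None -> a != b ->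
  prob R (fun w : outcome m n k => ~~ separated (graph_of w) u v)
    <= (1 - (#|adjacency m n| ^ 2)%:R^-1) ^+ (k - 2).
Proof.
move=> uv a0 b0 ab; pose D : finType := {x : 'I_k | (u != x) && (v != x)}.
have ux (x : D) : u != val x by case/andP: (valP x).
have vx (x : D) : v != val x by case/andP: (valP x).
pose f (xb : D * bool) : vpair k :=
  if xb.2 then coord (ux xb.1) else coord (vx xb.1).
pose t (xb : D * bool) : adjacency m n :=
  if xb.2 then orient a u (val xb.1) else orient b v (val xb.1).
(* Independence of the trials: a clash between two coordinates would force [u = v] or put [u] or [v]
   in [D]. *)
have injf : injective f.
  move=> [x [|]] [y [|]]; rewrite /f /= => /coord_eq [[e1 e2]|[e1 e2]].
  all: try by rewrite (val_inj e2).
  - by case/eqP: (ux y).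
  - by case/eqP: uv.
  - by case/eqP: (ux y).
  - by case/eqP: uv.
  - by case/eqP: (vx y).
  - by case/eqP: (vx y).
have cardD : size (enum D) = (k - 2)%N.
  rewrite -cardT card_sig -[in RHS](card_ord k) -(cardC (pred2 u v)) card2 uv.
  rewrite addnC addnK; apply: eq_card => x.
  by rewrite !inE negb_or ![x == _]eq_sym.
have := card_avoid_pairs t injf (enum_uniq D); rewrite cardD.
set avoid := [pred w | _] => le_avoid.
have le_card : (#|(fun w : outcome m n k => ~~ separated (graph_of w) u v)|
    <= #|avoid|)%N.
  apply: subset_leq_card; apply/fintype.subsetP => w; apply: contraR.
  case/allPn => x _ /negPn /forallP hit; apply/existsP; exists (val x).
  have := hit true; have := hit false; rewrite /f /t /= !adj_of_coord.
  by move=> /eqP -> /eqP ->; apply/and3P.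
have N0 : (0 < #|adjacency m n|)%N by rewrite card_adjacency addn1.
rewrite probE; set N := #|adjacency m n| in N0 le_avoid *.
have N2 : (0 < N ^ 2)%N by rewrite expn_gt0 N0.
have -> : 1 - (N ^ 2)%:R^-1 = (N ^ 2).-1%:R / (N ^ 2)%:R :> R.
  rewrite -subn1 natrB // mulrBl mulfV ?mul1r // pnatr_eq0.
  by rewrite -lt0n.
rewrite expr_div_n ler_pdivrMr ?ltr0n ?expn_gt0 ?N0 // mulrAC.
rewrite ler_pdivlMr ?exprn_gt0 ?ltr0n // -!natrX -!natrM ler_nat.
rewrite [X in (_ <= X)%N]mulnC; apply: leq_trans le_avoid.
by rewrite leq_mul2r le_card orbT.
Qed.

Lemma prob_le (R : realType) (m n k : nat) (E F : pred (outcome m n k)) :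
  {subset E <= F} -> prob R E <= prob R F.
Proof.
move=> EF; rewrite !probE ler_wpM2r ?invr_ge0 ?ler0n // ler_nat.
by apply: subset_leq_card; apply/fintype.subsetP.
Qed.

Lemma prob_predC (R : realType) (m n k : nat) (E : pred (outcome m n k)) :
  prob R E = 1 - prob R (predC E).
Proof.
rewrite -(prob_predT R m n k) /prob [in RHS](bigID E) /=.
by rewrite addrK.
Qed.

Lemma prob_exists (R : realType) (m n k : nat) (I : finType) (P : pred I)
    (E : I -> pred (outcome m n k)) :
  prob R (fun w => [exists i, P i && E i w]) <= \sum_(i | P i) prob R (E i).
Proof.
rewrite /prob; under [leRHS]eq_bigr do rewrite big_mkcond.
rewrite exchange_big big_mkcond; apply: ler_sum => w _.
have pos : 0 <= \prod_(p : vpair k) (2 * m + n + 1)%N%:R^-1 :> R.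
  by apply: prodr_ge0 => p _; rewrite invr_ge0 ler0n.
case: ifP => [/existsP[i /andP[Pi Ei]]|_]; last first.
  by apply: sumr_ge0 => i _; case: ifP.
rewrite (bigD1 i) //= Ei lerDl; apply: sumr_ge0 => j _.
by case: ifP.
Qed.

(** With no arc color there are at least two edge colors; otherwise the two directions of one arc
    color serve. *)
Lemma two_adjacencies (m n : nat) :
  (m, n) <> (0%N, 1%N) -> (m, n) <> (0%N, 0%N) ->
  exists a b : adjacency m n, [/\ a != None, b != None & a != b].
Proof.
case: m n => [|m] [|[|n]] // _ _.
- by exists (Some (inr ord0)), (Some (inr (lift ord0 ord0))).
all: by exists (Some (inl (ord0, true))), (Some (inl (ord0, false))).
Qed.

Lemma prob_clique_ge (R : realType) (m n k : nat) :
  (m, n) <> (0%N, 1%N) -> (m, n) <> (0%N, 0%N) ->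
  1 - k%:R ^+ 2 * (1 - (#|adjacency m n| ^ 2)%:R^-1) ^+ (k - 2)
    <= prob R (fun w : outcome m n k => clique (graph_of w)).
Proof.
move=> h01 h00; have [a [b [a0 b0 ab]]] := two_adjacencies h01 h00.
rewrite prob_predC lerB //.
pose E (p : 'I_k * 'I_k) : pred (outcome m n k) :=
  fun w => ~~ separated (graph_of w) p.1 p.2.
apply: le_trans (_ : prob R (fun w => [exists p, (p.1 != p.2) && E p w]) <= _).
  apply: prob_le => w; apply: contraR => /existsPn sepw.
  apply: separated_clique => u v uv.
  by have := sepw (u, v); rewrite uv /= negbK.
apply: le_trans (prob_exists _ _ _) _.
apply: le_trans (ler_sum _ (fun p uv => prob_not_separated R uv a0 b0 ab)) _.
(* The sum runs over ordered pairs, at most [k ^ 2] of them. *)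
rewrite sumr_const -[leLHS]mulr_natl ler_wpM2r //.
  have M0 : (0 < #|adjacency m n| ^ 2)%N.
    by rewrite expn_gt0 card_adjacency addn1.
  by rewrite exprn_ge0 // subr_ge0 invf_le1 ?ler1n ?ltr0n.
by rewrite -natrX ler_nat (leq_trans (max_card _)) // card_prod !card_ord.
Qed.

(** Two uses of [1 + x <= expR x] give [(1 - 1/M)^k <= exp(-k/M) = exp(-k/(3M))^3 <= (1 +
    k/(3M))^-3]; this cubic decay beats the quadratic factor. *)
Lemma sqr_expr_cvg0 (R : realType) (M : nat) : (0 < M)%N ->
  (fun k => k%:R ^+ 2 * (1 - M%:R^-1) ^+ (k - 2)) @ \oo --> (0 : R).
Proof.
(* The shift removes the truncated subtraction and turns the factor into [(k + 2)^2]. *)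
move=> M0; rewrite -(cvg_shiftn 2) /=.
have M1 : 1 <= M%:R :> R by rewrite ler1n.
have le0c : 0 <= 1 - M%:R^-1 :> R by rewrite subr_ge0 invf_le1 ?ltr0n.
apply: (@squeeze_cvgr _ _ _ _ (fun=> 0) (fun k => (3 * M%:R) ^+ 3 * harmonic k)).
- near=> k; rewrite addnK mulr_ge0 ?exprn_ge0 //=.
  have lec : (1 - M%:R^-1) ^+ k <= (1 + k%:R / (3 * M%:R)) ^- 3 :> R.
    apply: le_trans (_ : expR (- (k%:R / M%:R)) <= _).
      rewrite -mulrN expRM_natl lerXn2r ?nnegrE ?expR_ge0 //.
      exact: expR_ge1Dx.
    have -> : k%:R / M%:R = 3%:R * (k%:R / (3 * M%:R)) :> R.
      by field; rewrite pnatr_eq0 -lt0n.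
    have pos : 0 < 1 + k%:R / (3 * M%:R) :> R.
      by rewrite ltr_wpDr // divr_ge0 // mulr_ge0.
    rewrite expRN expRM_natl lef_pV2 ?posrE ?exprn_gt0 ?expR_gt0 //.
    by rewrite lerXn2r ?nnegrE ?expR_ge0 ?(ltW pos) // expR_ge1Dx.
  apply: le_trans (ler_wpM2l _ lec) _; first by rewrite exprn_ge0.
  have k0 : 0 <= k%:R :> R by [].
  have -> : (1 + k%:R / (3 * M%:R)) ^- 3 =
      (3 * M%:R) ^+ 3 / (3 * M%:R + k%:R) ^+ 3 :> R.
    field; rewrite pnatr_eq0 -lt0n M0 andbT; lra.
  rewrite mulrCA ler_pM2l ?exprn_gt0 ?mulr_gt0 ?ltr0n //.
  rewrite ler_pdivrMr ?exprn_gt0 ?ltr_pwDl ?mulr_gt0 ?ltr0n //.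
  (* What remains is [(k + 2)^2 * (k + 1) <= (3M + k)^3], true factor by factor since [M >= 1]. *)
  rewrite mulrC ler_pdivlMr // natrD -natr1 [leRHS]exprSr.
  apply: ler_pM; rewrite ?exprn_ge0 ?addr_ge0 //; last lra.
  rewrite lerXn2r ?nnegrE ?addr_ge0 ?mulr_ge0 //; lra.
- exact: cvg_cst.
- rewrite -(mulr0 ((3 * M%:R) ^+ 3)); apply: cvgMr; exact: cvg_harmonic.
Unshelve. all: by end_near. Qed.

Theorem theorem1 (R : realType) (m n : nat)
    (hmn01 : (m, n) <> (0%N, 1%N)) (hmn00 : (m, n) <> (0%N, 0%N)) :
  (fun k : nat => prob R (fun w : outcome m n k => clique (graph_of w)))
    @ \oo --> (1 : R).
Proof.
pose M := (#|adjacency m n| ^ 2)%N.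
have M0 : (0 < M)%N by rewrite expn_gt0 card_adjacency addn1.
apply: (@squeeze_cvgr _ _ _ _
  (fun k => 1 - k%:R ^+ 2 * (1 - M%:R^-1) ^+ (k - 2)) (fun=> 1)).
- near=> k; rewrite prob_clique_ge //= -(prob_predT R m n k).
  exact: prob_le.
- rewrite -[X in _ --> X]subr0; apply: cvgB; first exact: cvg_cst.
  exact: sqr_expr_cvg0.
- exact: cvg_cst.
Unshelve. all: by end_near. Qed.
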